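(* Let $q=p^m$ with $p$ an odd prime number and $m>1$. Let $V$ be a subgroup of the additive group $(\mathbb{F}_q,+)$ of order $p^{m-1}$, and write $\mathbb{F}_q/V=\{\overline{0},\overline{b},\dots,(p-1)\overline{b}\}$, where $\overline{b}=b+V$ is a generator of $\mathbb{F}_q/V$. Let $c_1,c_2,\dots,c_{p-2}\in b+V$ be distinct. Let $1\le k<n$ and let $\alpha_1,\dots,\alpha_n$ be distinct elements of $V\cup\{c_1,\dots,c_{p-2},\infty\}$; put $\bm\alpha=(\alpha_1,\dots,\alpha_n)$. If $\eta\in\mathbb{F}_q^*$ satisfies $(-\eta)^{-1}\in(p-1)b+V$, then the twisted Reed-Solomon code $TRS_{k,n}[\bm\alpha,1,k-1,\eta]$ is MDS.
   Context: For $\eta\in\mathbb{F}_q^*$ and distinct $\alpha_1,\dots,\alpha_n\in\mathbb{F}_q\cup\{\infty\}$, the twisted Reed-Solomon code with twist parameters $(t,h)=(1,k-1)$ is $$TRS_{k,n}[\bm\alpha,1,k-1,\eta]=\Big\{(f(\alpha_1),\dots,f(\alpha_n)) : f=\sum_{i=0}^{k-1}f_ix^i+\eta f_{k-1}x^{k},\ f_0,\dots,f_{k-1}\in\mathbb{F}_q\Big\}\subseteq\mathbb{F}_q^n,$$ where, for such $f$, the value $f(\infty)$ is defined to be the coefficient $f_{k-1}$ of $x^{k-1}$. A linear code of length $n$, dimension $k$ and minimum Hamming distance $d$ is MDS if $d=n-k+1$; here ''MDS'' means an MDS code of length $n$ and dimension $k$. *)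

(* Defs.v *)
From HB Require Import structures.
From mathcomp Require Import all_boot all_order all_fingroup all_algebra all_solvable.

Set Implicit Arguments.
Unset Strict Implicit.
Unset Printing Implicit Defensive.

Import GRing.Theory.
Local Open Scope ring_scope.

Section Codes.
Variables (F : finFieldType) (n : nat).
Implicit Types (C : {set 'rV[F]_n}) (x y : 'rV[F]_n).

Definition hamming_dist x y : nat := #|[set i | x 0 i != y 0 i]|.

Definition has_min_dist C (d : nat) : Prop :=
  (exists x y, [/\ x \in C, y \in C, x != y & hamming_dist x y = d]) /\
  (forall x y, x \in C -> y \in C -> x != y -> (d <= hamming_dist x y)%N).

Definition is_linear_code C (k : nat) : Prop :=
  exists2 U : {vspace 'rV[F]_n}, C = [set x | x \in U] & \dim U = k.

(* [n - k] does not truncate: being a linear code of dimension [k] forces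
   [k <= n]. *)
Definition is_MDS C (k : nat) : Prop :=
  is_linear_code C k /\ has_min_dist C (n - k + 1)%N.

End Codes.

Section TwistedReedSolomon.
Variable F : finFieldType.

(* Twist parameters (t, h) = (1, k - 1); meaningful only for [0 < k]. *)
Definition trs_poly (k : nat) (eta : F) (f : k.-tuple F) : {poly F} :=
  \sum_(i < k) f`_i *: 'X^i + (eta * f`_(k.-1)) *: 'X^k.

(* Points of F ∪ {∞} are elements of [option F], with [None] standing for ∞. *)
Definition trs_eval (k : nat) (g : {poly F}) (a : option F) : F :=
  if a is Some z then g.[z] else g`_(k.-1).

Definition TRS (k n : nat) (alpha : 'I_n -> option F) (eta : F) :
    {set 'rV[F]_n} :=
  [set \row_(j < n) trs_eval k (trs_poly eta f) (alpha j) | f : k.-tuple F].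

End TwistedReedSolomon.

(* Main.v *)
(* A nonzero message has a codeword with at least k zeros only if its twisted
   polynomial g has degree k with k distinct finite evaluation points as roots:
   otherwise g is untwisted of degree at most k - 2, whether or not ∞ is one of
   the zeros.  By Vieta those roots then sum to (-eta)^-1.  A sum of distinct
   elements of V and r of the c_i lies in r b + V with r <= p - 2, hence never in
   (p - 1) b + V because b has order p modulo V. *)

Require Import Defs.
From HB Require Import structures.
From mathcomp Require Import all_boot all_order all_fingroup all_algebra all_solvable.
From mathcomp Require Import zify.

Set Implicit Arguments.
Unset Strict Implicit.
Unset Printing Implicit Defensive.

Import GRing.Theory.
Local Open Scope ring_scope.

(** * MDS codes as images of linear maps *)

Lemma hamming_dist_linear (F : finFieldType) k n
    (phi : {linear 'rV[F]_k -> 'rV[F]_n}) (v w : 'rV[F]_k) :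
  (hamming_dist (phi v) (phi w) + #|[set j | phi (v - w)%R 0%R j == 0%R]|)%N = n.
Proof.
rewrite /hamming_dist -[RHS]card_ord -(cardsC [set i | phi v 0 i != phi w 0 i]).
congr (_ + _)%N; apply: eq_card => j.
by rewrite !inE raddfB !mxE subr_eq0 negbK.
Qed.

(* Minimality of the distance is the Singleton bound, obtained by pigeonhole:
   two messages have encodings that agree on the first [k - 1] coordinates. *)
Lemma is_MDS_linear_image (F : finFieldType) k n
    (phi : {linear 'rV[F]_k -> 'rV[F]_n}) :
  (0 < k)%N -> (k <= n)%N ->
  (forall v : 'rV[F]_k, v != 0 -> (#|[set j | phi v 0%R j == 0%R]| < k)%N) ->
  is_MDS [set phi v | v : 'rV[F]_k] k.
Proof.
move=> k_gt0 le_kn few0.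
have phi_inj : injective phi.
  (* A nonzero kernel vector would have an image with n zeros, and k <= n. *)
  move=> v w eq_vw; apply/eqP; rewrite -subr_eq0; apply/negPn/negP => /few0.
  rewrite raddfB /= eq_vw subrr ltnNge => /negP; apply.
  rewrite (_ : [set _ | _] = setT) ?cardsT ?card_ord //.
  by apply/setP => j; rewrite !inE mxE eqxx.
have zeros_lt d z : (d + z = n)%N -> (z < k)%N = (n - k + 1 <= d)%N by lia.
have zeros_ge d z : (d + z = n)%N -> (k.-1 <= z)%N = (d <= n - k + 1)%N by lia.
have dist_ge (v w : 'rV[F]_k) :
    v != w -> (n - k + 1 <= hamming_dist (phi v) (phi w))%N.
  rewrite -subr_eq0 => /few0.
  by rewrite (zeros_lt _ _ (hamming_dist_linear phi v w)).
split; last split.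
- exists (limg (linfun phi)).
    apply/setP => x; rewrite inE; apply/imsetP/memv_imgP => [[v _ ->]|[v _ ->]].
      by exists v; rewrite ?memvf ?lfunE.
    by exists v; rewrite ?lfunE.
  rewrite limg_dim_eq ?dimvf /dim /= ?mul1n //.
  apply/eqP; rewrite capfv; apply/lker0P => v w.
  by rewrite !lfunE; apply: phi_inj.
- have lt_kn : (k.-1 <= n)%N by lia.
  pose psi v := \row_i phi v 0 (widen_ord lt_kn i).
  have /injectivePn[v [w neq_vw eq_vw]] : ~~ injectiveb psi.
    apply/negP => /injectiveP/leq_card; rewrite !card_mx !mul1n leq_exp2l.
      lia.
    exact: card_finNzRing_gt1.
  exists (phi v), (phi w); split; rewrite ?imset_f ?(inj_eq phi_inj) //.
  apply/eqP; rewrite eqn_leq dist_ge // andbT -(zeros_ge _ _ (hamming_dist_linear phi v w)).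
  have widen_inj : injective (widen_ord lt_kn).
    by move=> i j /(congr1 val)/= /val_inj.
  rewrite -[k.-1]card_ord -(card_imset _ widen_inj).
  apply/subset_leq_card/subsetP => j /imsetP[i _ ->]; rewrite inE.
  by have /rowP/(_ i) := eq_vw; rewrite raddfB !mxE => ->; rewrite subrr.
- move=> x y /imsetP[v _ ->] /imsetP[w _ ->]; rewrite (inj_eq phi_inj).
  exact: dist_ge.
Qed.

(** * Coefficients and roots of twisted polynomials *)

Section TwistedPolynomials.
Variables (F : finFieldType) (k : nat) (eta : F).
Implicit Types (f : k.-tuple F) (s : seq F).

Lemma coef_trs_poly f i :
  (trs_poly eta f)`_i = f`_i + (eta * f`_k.-1) *+ (i == k).
Proof.
rewrite /trs_poly coefD coefZ coefXn mulr_natr; congr (_ + _).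
rewrite -(poly_def k (fun i => f`_i)) coef_poly; case: ltnP => // le_ki.
by rewrite nth_default ?size_tuple.
Qed.

Lemma size_trs_poly f : (size (trs_poly eta f) <= k.+1)%N.
Proof.
apply/leq_sizeP => i lt_ki; rewrite coef_trs_poly gtn_eqF //.
by rewrite nth_default ?addr0 // size_tuple ltnW.
Qed.

Lemma size_trs_poly_untwisted f :
  f`_k.-1 = 0 -> (size (trs_poly eta f) <= k.-1)%N.
Proof.
move=> f0; apply/leq_sizeP => i; rewrite coef_trs_poly f0 mulr0 mul0rn addr0.
rewrite leq_eqVlt => /predU1P[<- //|lt_ki].
by rewrite nth_default // size_tuple; lia.
Qed.

(* Vieta: the coefficients of degrees [k] and [k - 1] are in ratio [eta]. *)
Lemma sum_roots_trs_poly f s :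
  (0 < k)%N -> eta != 0 -> f`_k.-1 != 0 ->
  uniq s -> size s = k -> all (root (trs_poly eta f)) s ->
  \sum_(x <- s) x = (- eta)^-1.
Proof.
move=> k_gt0 eta0 f0 s_uniq s_size s_roots.
have coef_k : (trs_poly eta f)`_k = eta * f`_k.-1.
  by rewrite coef_trs_poly eqxx nth_default ?size_tuple // add0r.
have size_g : size (trs_poly eta f) = k.+1.
  apply/eqP; rewrite eqn_leq size_trs_poly ltnNge.
  apply/negP => /leq_sizeP/(_ k (leqnn _))/eqP.
  by rewrite coef_k mulf_eq0 (negPf eta0) (negPf f0).
have g_prod := all_roots_prod_XsubC
  (etrans size_g (congr1 _ (esym s_size))) s_roots
  (etrans (uniq_rootsE s) s_uniq).
have := congr1 (fun q : {poly F} => q`_k.-1) g_prod.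
have sum_coef : (\prod_(x <- s) ('X - x%:P))`_k.-1 = - \sum_(x <- s) x.
  by rewrite -s_size coefPn_prod_XsubC // s_size -lt0n.
rewrite coefZ sum_coef /lead_coef size_g /= coef_k coef_trs_poly.
rewrite (_ : (k.-1 == k) = false) ?addr0; last lia.
move=> eq_f; have neta0 : - eta != 0 by rewrite oppr_eq0.
apply: (mulfI neta0); rewrite divff //; apply: (mulIf f0).
by rewrite mul1r [RHS]eq_f mulrAC mulNr mulrN mulNr.
Qed.

Lemma trs_zeros_lt n (alpha : 'I_n -> option F) f :
  (0 < k)%N -> eta != 0 -> injective alpha -> (exists i : 'I_k, f`_i != 0) ->
  (forall s, uniq s -> {subset map Some s <= codom alpha} ->
     \sum_(x <- s) x != (- eta)^-1) ->
  (#|[set j | trs_eval k (trs_poly eta f) (alpha j) == 0%R]| < k)%N.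
Proof.
move=> k_gt0 eta0 alpha_inj [i fi0] sum_neq.
set g := trs_poly eta f; set Z := [set _ | _].
have g0 : g != 0.
  apply: contraNneq fi0 => g0.
  have : g`_i = 0 by rewrite g0 coef0.
  by rewrite coef_trs_poly ltn_eqF // addr0 => ->.
(* [t] lists the evaluation points where the codeword vanishes, and [s] the finite ones among
   them. *)
pose t := [seq alpha j | j <- enum Z]; pose s := pmap id t.
have t_uniq : uniq t by rewrite map_inj_uniq ?enum_uniq.
have Some_s : map Some s = filter isSome t.
  by apply: pmap_filter => -[].
have s_uniq : uniq s.
  by rewrite -(map_inj_uniq (@Some_inj _)) Some_s filter_uniq.
have mem_s x : x \in s -> exists2 j, j \in Z & Some x = alpha j.
  rewrite -(mem_map (@Some_inj _)) Some_s mem_filter => /andP[_].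
  by case/mapP => j; rewrite mem_enum => *; exists j.
have s_roots : all (root g) s.
  by apply/allP => x /mem_s[j]; rewrite inE => + eq_x; rewrite -eq_x.
have s_sub : {subset map Some s <= codom alpha}.
  by move=> _ /mapP[x /mem_s[j _ eq_x] ->]; rewrite eq_x codom_f.
(* By injectivity of [alpha], ∞ accounts for at most one zero. *)
have size_s : (size s + (None \in t) = #|Z|)%N.
  rewrite -(size_map Some) Some_s size_filter -count_uniq_mem //.
  rewrite cardE -(size_map alpha) -(count_predC isSome); congr (_ + _)%N.
  by apply: eq_count; case.
have lt_s_g : (size s < size g)%N := max_poly_roots g0 s_roots s_uniq.
rewrite ltnNge; apply/negP => le_kZ.
(* If the top coefficient vanishes, there are at most k - 2 finite roots, hence at most k - 1 zeros
   with ∞. Otherwise the value at ∞ is nonzero, and k or more finite roots of a polynomial of degree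
   at most k are exactly k. *)
have [f0|f0] := eqVneq f`_k.-1 0.
  have le_g : (size g <= k.-1)%N := size_trs_poly_untwisted f0.
  by have := leq_b1 (None \in t); lia.
have None_t : (None \in t) = false.
  apply/negP => /mapP[j]; rewrite mem_enum inE => + eq_j; rewrite -eq_j /=.
  by rewrite coef_trs_poly (_ : (k.-1 == k) = false) ?addr0 ?(negPf f0) //; lia.
have size_s_k : size s = k.
  have le_g : (size g <= k.+1)%N := size_trs_poly f.
  by move: size_s; rewrite None_t; lia.
by have /eqP[] := sum_neq s s_uniq s_sub; apply: sum_roots_trs_poly s_roots.
Qed.

(** Messages become row vectors, so that encoding is a linear map. *)
Definition trs_encode n (alpha : 'I_n -> option F) (v : 'rV[F]_k) : 'rV[F]_n :=
  \row_j trs_eval k (trs_poly eta [tuple v 0 i | i < k]) (alpha j).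

Lemma nth_row_tuple (v : 'rV[F]_k) j :
  [tuple v 0 i | i < k]`_j = if insub j is Some i then v 0 i else 0.
Proof.
case: insubP => [i _ <-|]; first by rewrite -tnth_nth tnth_mktuple.
by rewrite -leqNgt => le_kj; rewrite nth_default ?size_tuple.
Qed.

Lemma trs_encode_is_linear n (alpha : 'I_n -> option F) :
  linear (trs_encode alpha).
Proof.
move=> a v w; apply/rowP => j; rewrite !mxE.
have -> : trs_poly eta [tuple (a *: v + w) 0 i | i < k] =
    a *: trs_poly eta [tuple v 0 i | i < k]
    + trs_poly eta [tuple w 0 i | i < k].
  have lin l : [tuple (a *: v + w) 0 i | i < k]`_l =
      a * [tuple v 0 i | i < k]`_l + [tuple w 0 i | i < k]`_l.
    rewrite !nth_row_tuple; case: insub => [i|]; rewrite ?mxE //.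
    by rewrite mulr0 addr0.
  apply/polyP => l; rewrite coef_trs_poly coefD coefZ !coef_trs_poly !lin.
  by rewrite !(mulrDr, mulrnDl, mulrnAr) mulrCA addrACA.
by case: (alpha j) => [z|] /=; rewrite !(hornerD, hornerZ, coefD, coefZ).
Qed.

HB.instance Definition _ n (alpha : 'I_n -> option F) :=
  GRing.isLinear.Build F 'rV[F]_k 'rV[F]_n _ (trs_encode alpha)
    (trs_encode_is_linear alpha).

Lemma TRS_imset n (alpha : 'I_n -> option F) :
  TRS k alpha eta = [set trs_encode alpha v | v : 'rV[F]_k].
Proof.
apply/setP => x; apply/imsetP/imsetP => [[f _ ->]|[v _ ->]].
  exists (\row_i tnth f i); rewrite // /trs_encode.
  suff -> : [tuple (\row_i tnth f i) 0 i | i < k] = f by [].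
  by apply: eq_from_tnth => i; rewrite tnth_mktuple mxE.
by exists [tuple v 0 i | i < k].
Qed.

(** Isolates the additive condition on the finite evaluation points; the subgroup and its cosets
    serve only to verify it. *)
Lemma TRS_is_MDS n (alpha : 'I_n -> option F) :
  (0 < k)%N -> (k <= n)%N -> eta != 0 -> injective alpha ->
  (forall s, uniq s -> {subset map Some s <= codom alpha} ->
     \sum_(x <- s) x != (- eta)^-1) ->
  is_MDS (TRS k alpha eta) k.
Proof.
move=> k_gt0 le_kn eta0 alpha_inj sum_neq; rewrite TRS_imset.
apply: is_MDS_linear_image => // v v0.
have [i vi0] : exists i, v 0 i != 0.
  apply/existsP; apply: contraNT v0 => /existsPn v0; apply/eqP/rowP => i.
  by rewrite mxE; apply/eqP/negPn/v0.
under eq_finset => j do rewrite mxE.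
apply: trs_zeros_lt => //; exists i.
by rewrite -tnth_nth tnth_mktuple.
Qed.

End TwistedPolynomials.

(** * Sums modulo the subgroup V *)

Section Cosets.
Variables (F : finFieldType) (V : {group F}).

Lemma add_subgroup x y : x \in V -> y \in V -> x + y \in V.
Proof. exact: groupM. Qed.

Lemma opp_subgroup x : x \in V -> - x \in V.
Proof. by move=> Vx; rewrite -FinRing.zmodVgE groupV. Qed.

Lemma mem_lcoset_sub x y : (y \in (x *: V)%g) = (y - x \in V).
Proof. by rewrite mem_lcoset FinRing.zmodVgE FinRing.zmodMgE addrC. Qed.

(** Modulo V, each entry outside V contributes one b and every other entry contributes 0. *)
Lemma sum_coset_count b (s : seq F) :
  (forall x, x \in s -> (x \in V) || (x - b \in V)) ->
  \sum_(x <- s) x - b *+ count [predC V] s \in V.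
Proof.
elim: s => [|x s IHs] sV /=.
  by rewrite big_nil subr0; apply: group1.
have {}IHs := IHs (fun y s_y => sV y (mem_behead (s := x :: s) s_y)).
rewrite big_cons mulrnDr opprD addrACA; apply: add_subgroup => //.
have := sV x (mem_head _ _); case: (boolP (x \in V)) => //= Vx.
by rewrite subr0.
Qed.

(** The order of a generator of the quotient is the index of V, and it divides every d that sends
    the coset of b to the identity. *)
Lemma mulrn_mem_subgroup b d :
  generator ([set: F] / V)%g (coset V b) -> (b *+ d \in V) ->
  (#|[set: F] : V|%g %| d)%N.
Proof.
have nVF : [set: F] \subset 'N(V)%g.
  by apply: sub_abelian_norm (subsetT _); apply: FinRing.zmod_abelian.
move=> /eqP gen_b V_bd; rewrite -card_quotient // gen_b -/(order _) order_dvdn.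
have NVb : b \in 'N(V)%g by rewrite (subsetP nVF) ?inE.
by rewrite -morphX //= coset_id.
Qed.

End Cosets.

(* The group law of [{group F}], [coset] and [lcoset] is the addition of [F];
   [(b *: V)%g] is the coset b + V. *)
Theorem theorem3p5 (F : finFieldType) (p m : nat)
  (p_prime : prime p) (p_odd : odd p) (m_gt1 : (1 < m)%N)
  (cardF : #|F| = (p ^ m)%N)
  (V : {group F}) (cardV : #|V| = (p ^ m.-1)%N)
  (b : F) (b_gen : generator ([set: F] / V)%g (coset V b))
  (c : 'I_(p - 2) -> F) (c_inj : injective c)
  (c_coset : forall i, c i \in (b *: V)%g)
  (k n : nat) (k_ge1 : (1 <= k)%N) (k_lt_n : (k < n)%N)
  (alpha : 'I_n -> option F) (alpha_inj : injective alpha)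
  (alpha_in : forall j,
     alpha j \in None |: [set Some x | x in V :|: [set c i | i : 'I_(p - 2)]])
  (eta : F) (eta_neq0 : eta != 0)
  (eta_coset : (- eta)^-1 \in ((b *+ (p - 1)) *: V)%g) :
  is_MDS (TRS k alpha eta) k.
Proof.
apply: TRS_is_MDS => //; first exact: ltnW.
move=> s s_uniq s_alpha; apply/eqP => sum_s.
have s_in x : x \in s -> (x \in V) || (x \in codom c).
  move=> s_x; have /codomP[j eq_x] : Some x \in codom alpha.
    by rewrite s_alpha ?map_f.
  have := alpha_in j.
  rewrite -eq_x in_setU1 /= (mem_imset _ _ (@Some_inj _)) in_setU.
  by case/orP => [->//|/imsetP[i _ ->]]; rewrite codom_f orbT.
have sV x : x \in s -> (x \in V) || (x - b \in V).
  case/s_in/orP => [->//|/codomP[i ->]].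
  by rewrite -mem_lcoset_sub c_coset orbT.
(* The entries of [s] outside V are distinct and all occur among the p - 2 values of [c]. *)
have le_r : (count [predC V] s <= p - 2)%N.
  rewrite -size_filter -[leqRHS]card_ord -(size_codom c).
  apply: uniq_leq_size; first exact: filter_uniq.
  by move=> x; rewrite mem_filter inE => /andP[/negPf Vx /s_in]; rewrite Vx.
have p_gt1 := prime_gt1 p_prime.
have index_V : #|[set: F] : V|%g = p.
  apply/eqP; rewrite -(eqn_pmul2l (cardG_gt0 V)) Lagrange ?subsetT //.
  rewrite cardsT cardF cardV.
  by rewrite -expnSr prednK // ltnW.
have := sum_coset_count sV; rewrite sum_s => Vr.
(* The sum lies both in r b + V and in (p - 1) b + V, with r the count; subtracting gives a multiple
   of b in V whose factor is between 1 and p - 1, so p cannot divide it. *)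
have : b *+ (p - 1 - count [predC V] s) \in V.
  rewrite mulrnBr; last lia.
  move: eta_coset; rewrite mem_lcoset_sub => /opp_subgroup /(add_subgroup Vr).
  by rewrite opprB addrC addrA subrK.
move/(mulrn_mem_subgroup b_gen); rewrite index_V => /dvdn_leq; lia.
Qed.
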